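(* Let $\ell\geq 2$ be an integer. The conditions $u_k=0$ for $0\leq k\leq \ell-1$ are necessary to claim the Hardy-Rellich type inequality $$\sum_{2n\geq \ell}|\Delta^{\frac{\ell}{2}}u_n|^2\geq \Big[\frac{(2\ell)!}{4^\ell\,\ell!}\Big]^2\sum_{n=\ell}^\infty\frac{u_n^2}{n^{2\ell}}.$$ In the case $\ell=2$: if $u_1\neq 0$ is allowed (still with $u_0=0$), this inequality cannot hold in general, even if the constant on the right-hand side is replaced by any $\epsilon>0$; that is, for every $\epsilon>0$ there is $u\in C_c(\mathbb{N})$ with $u_0=0$ and $u_1\neq 0$ such that $$\sum_{n\geq 1}|\Delta u_n|^2<\epsilon\sum_{n\geq 2}\frac{u_n^2}{n^4}.$$ The other cases of $\ell$ can be handled similarly.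
   Context: $\mathbb{N}=\{0,1,2,\dots\}$ and $C_c(\mathbb{N})$ is the space of finitely supported real sequences $u=(u_n)_{n\in\mathbb{N}}$. For $n\geq 1$, $\nabla u_n=u_n-u_{n-1}$ and $\Delta u_n=2u_n-u_{n+1}-u_{n-1}$. For even $\ell$, $\Delta^{\ell/2}$ is the iterated Laplacian; for odd $\ell$, $\Delta^{\ell/2}$ means $\nabla\Delta^{(\ell-1)/2}$. The displayed Hardy-Rellich inequality is known to hold for every $\ell\ge 2$ and every $u\in C_c(\mathbb{N})$ satisfying $u_k=0$ for all $0\leq k\leq \ell-1$; the remark concerns the necessity of these vanishing conditions. *)

(* Defs.v *)
From HB Require Import structures.
From mathcomp Require Import all_boot all_order all_algebra.
From mathcomp Require Import all_classical all_reals all_analysis.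

Set Implicit Arguments.
Unset Strict Implicit.
Unset Printing Implicit Defensive.

Import Order.TTheory GRing.Theory Num.Theory.

Local Open Scope classical_set_scope.
Local Open Scope ring_scope.

Section HardyRellich.
Context {R : realType}.
Implicit Types (u : nat -> R) (l n : nat).

Definition finitely_supported u : Prop := finite_set [set n | u n != 0].

(* [nabla] and [laplacian] are meant for n >= 1 only. Since n.-1 = 0 at n = 0,
   their values there are irrelevant; they never enter [energy] below, because
   [half_laplacian l u n] with l <= 2n only reads u at the nonnegative indices
   n - uphalf l, ..., n + l./2, through values of the iterates at indices
   >= 1. *)
Definition nabla u n : R := u n - u n.-1.

Definition laplacian u n : R := 2 * u n - u n.+1 - u n.-1.

(* Delta^(l/2), with Delta^(l/2) = nabla Delta^((l-1)/2) for odd l. *)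
Definition half_laplacian l u : nat -> R :=
  let v := iter l./2 laplacian u in if odd l then nabla v else v.

(* For finitely supported u, the two series below have finitely many nonzero
   terms, so the limits defining them exist. *)
Definition energy l u : R :=
  \big[+%R/0]_(0 <= n <oo | (l <= 2 * n)%N) `|half_laplacian l u n| ^+ 2.

Definition hardy_sum l u : R :=
  \big[+%R/0]_(l <= n <oo) (u n ^+ 2 / n%:R ^+ (2 * l)).

Definition hardy_rellich_const l : R :=
  ((2 * l)`!%:R / (4 ^+ l * l`!%:R)) ^+ 2.

End HardyRellich.

Arguments hardy_rellich_const : clear implicits.

(* Main.v *)
(** Up to sign and a shift of the index, [half_laplacian l] is the [l]-th
    forward difference, so the energy kills polynomials of degree [< l].  Let
    [p] be the polynomial of degree [l - 1] vanishing at all [j < l] except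
    [k], and let [r n] be the product of the [N + i - n] for [i < l]: as [r]
    has [l] consecutive zeros starting at [N], the truncation of [p r] at [N]
    has the same [l]-th differences as [p r] at indices below [N] and
    vanishing ones from [N] on.  Each of the [2 l - 1] linear factors is [O(N)] with
    bounded slope, so these differences are [O(N ^ (l - 1))] and the energy is
    [O(N ^ (2 l - 1))], while the single term [n = l] of the Hardy sum is
    already of order [N ^ (2 l)]. *)

Require Import Defs.
From HB Require Import structures.
From mathcomp Require Import all_boot all_order all_algebra.
From mathcomp Require Import all_classical all_reals all_analysis.
From mathcomp Require Import zify ring lra.

Import Order.TTheory GRing.Theory Num.Theory.

Local Open Scope ring_scope.

(** * Iterated differences of products of affine factors *)

Definition fdiff (V : zmodType) (f : nat -> V) (n : nat) : V := f n.+1 - f n.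
Arguments fdiff {V} f n.

Lemma eq_iter_fdiff (V : zmodType) (f g : nat -> V) (i n : nat) :
  (forall m, (n <= m <= n + i)%N -> f m = g m) ->
  iter i fdiff f n = iter i fdiff g n.
Proof.
elim: i n => [|i IH] n fg /=; first by apply: fg; lia.
by rewrite /fdiff !IH // => m ?; apply: fg; lia.
Qed.

Lemma iter_fdiff0 (V : zmodType) (i n : nat) :
  iter i fdiff (fun=> 0 : V) n = 0.
Proof. by elim: i n => [//|i IH] n; rewrite /= /fdiff !IH subr0. Qed.

(** Leibniz rule: an affine factor has constant difference [a] and no higher ones, so only two terms
    survive. At [i = 0] the coefficient [i%:R] cancels the spurious second term. *)
Lemma iter_fdiff_mul_affine (R : comNzRingType) (a b : R) (f : nat -> R)
    (i n : nat) :
  iter i fdiff (fun m => (a * m%:R + b) * f m) n =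
  (a * n%:R + b) * iter i fdiff f n
  + i%:R * a * iter i.-1 fdiff f n.+1.
Proof.
elim: i n => [|i IH] n /=; first by rewrite !mul0r addr0.
rewrite {1}/fdiff !IH; case: i {IH} => [|i] /=; rewrite /fdiff -!natr1; ring.
Qed.

(** Each difference trades a value of size [M] for a slope of size 1, whence the weight [M ^+ i].
    Induction on the factors by the Leibniz rule, whose second term moves [(n, i)] to
    [(n + 1, i - 1)] and so keeps [n + i <= K]. *)
Lemma iter_fdiff_prod_affine_le (R : realDomainType) (l K : nat) (M : R)
    (s : seq (R * R)) :
  0 <= M ->
  (forall c, c \in s -> `|c.1| <= 1) ->
  (forall c n, c \in s -> (n <= K)%N -> `|c.1 * n%:R + c.2| <= M) ->
  forall i n, (i <= l)%N -> (n + i <= K)%N ->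
  M ^+ i * `|iter i fdiff (fun m => \prod_(c <- s) (c.1 * m%:R + c.2)) n|
  <= (l.+1%:R * M) ^+ size s.
Proof.
move=> M0; elim: s => [|[a b] s IH] slope_le val_le i n il niK /=.
  rewrite expr0; case: i il niK => [|i] _ _.
    by rewrite /= big_nil expr0 normr1 mulr1.
  rewrite iterSr (@eq_iter_fdiff _ _ (fun=> 0)) ?iter_fdiff0 ?normr0 ?mulr0 //.
  by move=> m _; rewrite /fdiff !big_nil subrr.
have {}IH := IH (fun c cs => slope_le c (mem_behead (s := (a, b) :: s) cs))
   (fun c n cs => val_le c n (mem_behead (s := (a, b) :: s) cs)).
have a1 : `|a| <= 1 by apply: (slope_le (a, b)); rewrite mem_head.
have abM : `|a * n%:R + b| <= M.
  by apply: (val_le (a, b)); [rewrite mem_head|lia].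
set f := fun m => \prod_(c <- s) (c.1 * m%:R + c.2).
rewrite (@eq_iter_fdiff _ _ (fun m => (a * m%:R + b) * f m)); last first.
  by move=> m _; rewrite big_cons.
rewrite iter_fdiff_mul_affine exprS.
set B := (l.+1%:R * M) ^+ size s.
have B0 : 0 <= B by rewrite exprn_ge0 // mulr_ge0.
(* The two Leibniz terms cost [M * B] and [i] times [M * B]; since [i <= l], a new factor costs at
   most [l.+1 * M]. *)
apply: (@le_trans _ _ (M * B + i%:R * (M * B))); last first.
  rewrite -mulrA -[X in X + _]mul1r -mulrDl.
  by rewrite ler_wpM2r ?mulr_ge0 // addrC natr1 ler_nat.
have Mi0 j : 0 <= M ^+ j by rewrite exprn_ge0.
apply: (le_trans (ler_wpM2l (Mi0 i) (ler_normD _ _))).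
rewrite mulrDr lerD //.
  rewrite normrM mulrCA; apply: ler_pM => //; first by rewrite mulr_ge0.
  exact: IH.
case: i il niK => [|i] il niK; first by rewrite !mul0r normr0 mulr0.
rewrite /= !normrM normr_nat; set X := `|iter i fdiff f n.+1|.
have -> : M ^+ i.+1 * (i.+1%:R * `|a| * X)
    = i.+1%:R * (M * (`|a| * (M ^+ i * X))) by rewrite exprS; ring.
rewrite ler_wpM2l // ler_wpM2l // -[leRHS]mul1r.
apply: ler_pM; rewrite ?mulr_ge0 ?normr_ge0 //.
by apply: IH; lia.
Qed.

(** * The energy through differences, and series with finitely many terms *)

Section HalfLaplacian.
Context {R : realType}.
Implicit Type u : nat -> R.

(** The Laplacian at [n] is minus the second difference at [n - 1]; [j <= n] keeps every subtraction
    from being truncated. *)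
Lemma iter_laplacianE u (j n : nat) : (j <= n)%N ->
  iter j laplacian u n = (-1) ^+ j * iter (2 * j)%N fdiff u (n - j)%N.
Proof.
elim: j n => [|j IH] n jn; first by rewrite mul1r subn0.
rewrite iterS {1}/laplacian !IH; try lia.
have -> : (2 * j.+1 = (2 * j).+2)%N by lia.
have -> : (n.+1 - j = (n - j.+1).+2)%N by lia.
have -> : (n - j = (n - j.+1).+1)%N by lia.
have -> : (n.-1 - j = n - j.+1)%N by lia.
rewrite !iterS /fdiff exprS; ring.
Qed.

Lemma norm_half_laplacian u (l n : nat) : (l <= 2 * n)%N ->
  `|half_laplacian l u n| = `|iter l fdiff u (n - uphalf l)%N|.
Proof.
move=> ln; rewrite /half_laplacian.
have lE := odd_double_half l; have uE := uphalf_half l.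
case: (odd l) lE uE => /= lE uE; last first.
  rewrite iter_laplacianE; last lia.
  rewrite normrM normrX normrN1 expr1n mul1r uE add0n.
  by have -> : (2 * l./2 = l)%N by lia.
rewrite /nabla !iter_laplacianE; try lia.
have -> : (n - l./2 = (n - uphalf l).+1)%N by lia.
have -> : (n.-1 - l./2 = n - uphalf l)%N by lia.
rewrite -mulrBr normrM normrX normrN1 expr1n mul1r.
have l_odd : l = (2 * l./2).+1 by lia.
by move: (n - uphalf l)%N => m; rewrite [in RHS]l_odd.
Qed.

Lemma series_eventually0 (F : nat -> R) (P : pred nat) (m K : nat) :
  (m <= K)%N -> (forall n, (K <= n)%N -> F n = 0) ->
  \big[+%R/0]_(m <= n <oo | P n) F n = \sum_(m <= n < K | P n) F n.
Proof.
move=> mK F0; apply/cvg_lim => //.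
rewrite -(cvg_shiftn K).
rewrite [X in (X @ _ --> _)%classic](_ : _ = fun=> \sum_(m <= n < K | P n) F n); first exact: cvg_cst.
apply/funext => i /=; rewrite (big_cat_nat (n := K)) ?leq_addl //=.
rewrite [X in _ + X]big_nat_cond [X in _ + X]big1 ?addr0 // => n.
by case/andP=> /andP[Kn _] _; apply: F0.
Qed.

End HalfLaplacian.

(** * The truncated polynomial and its energy *)

Section CutOff.
Context {R : realType}.
Variables (l k N : nat).

(** Slope and intercept of the factors of [p], then of [r]; all slopes are 1 or -1. *)
Definition cutoff_factors : seq (R * R) :=
  [seq (1, - j%:R) | j <- iota 0 l & j != k]
  ++ [seq (-1, (N + i)%:R) | i <- iota 0 l].

Definition cutoff_poly (n : nat) : R :=
  \prod_(c <- cutoff_factors) (c.1 * n%:R + c.2).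

Definition cutoff (n : nat) : R := if (n < N)%N then cutoff_poly n else 0.

Lemma cutoff_polyE n : cutoff_poly n =
  \prod_(0 <= j < l | j != k) (n%:R - j%:R)
  * \prod_(0 <= i < l) ((N + i)%:R - n%:R).
Proof.
rewrite /cutoff_poly big_cat /= !big_map big_filter /index_iota subn0.
congr (_ * _); apply: eq_bigr => i _; first by rewrite mul1r.
by rewrite mulN1r addrC.
Qed.

Lemma cutoff_poly_eq0 n :
  (n < l)%N && (n != k) || (N <= n < N + l)%N -> cutoff_poly n = 0.
Proof.
move=> nE; apply/eqP; rewrite cutoff_polyE mulf_eq0 !prodf_seq_eq0.
case/orP: nE => /andP[n1 n2]; apply/orP; [left|right]; apply/hasP.
  by exists n; rewrite ?mem_index_iota ?n1 // n2 subrr eqxx.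
exists (n - N)%N; first by rewrite mem_index_iota; lia.
by rewrite subnKC // subrr eqxx.
Qed.

Lemma cutoff_eq0 j : (j < l)%N -> j != k -> cutoff j = 0.
Proof.
by move=> jl jk; rewrite /cutoff cutoff_poly_eq0 ?jl ?jk //; case: ifP.
Qed.

Lemma cutoff_neq0 : (k < l <= N)%N -> cutoff k != 0.
Proof.
move=> klN; rewrite /cutoff ifT ?cutoff_polyE; last lia.
rewrite mulf_neq0 // prodf_seq_neq0; apply/allP => j; rewrite mem_index_iota.
  by move=> _; apply/implyP => jk; rewrite subr_eq0 eqr_nat eq_sym.
by move=> _; rewrite subr_eq0 eqr_nat; lia.
Qed.

Lemma finitely_supported_cutoff : finitely_supported cutoff.
Proof.
apply: (@sub_finite_set _ _ `I_N); last exact: finite_II.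
by move=> n /=; rewrite /cutoff; case: ltnP => //; rewrite eqxx.
Qed.

Lemma size_cutoff_factors : (k < l)%N -> size cutoff_factors = (l + l.-1)%N.
Proof.
move=> kl; rewrite size_cat !size_map size_iota addnC; congr addn.
have := count_predC (pred1 k) (iota 0 l).
rewrite size_filter size_iota (count_uniq_mem k (iota_uniq 0 l)) mem_iota.
by rewrite leq0n /= add0n kl add1n => /(congr1 predn).
Qed.

Lemma iter_fdiff_cutoff_le m : (k < l)%N -> (m < N)%N ->
  `|iter l fdiff cutoff m|
  <= l.+1%:R ^+ (l + l.-1) * (N + l)%:R ^+ l.-1.
Proof.
move=> kl mN.
(* As [m < N], the window from [m] to [m + l] ends before [N + l], so past [N] it meets only zeros
   of [r]. *)
rewrite (@eq_iter_fdiff _ _ cutoff_poly); last first.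
  move=> n nm; rewrite /cutoff; case: ltnP => // Nn.
  by rewrite cutoff_poly_eq0 //; lia.
have M0 : 0 < (N + l)%:R :> R by rewrite ltr0n; lia.
(* Multiplying by [M ^+ l], with [M = N + l], turns the right side into [l.+1 * M] to the power
   [2 l - 1], the number of factors. *)
rewrite -(ler_pM2l (exprn_gt0 l M0)) mulrCA -exprD -exprMn.
rewrite -size_cutoff_factors //.
apply: (@iter_fdiff_prod_affine_le _ l (N + l)) => //.
- by move=> c; rewrite mem_cat => /orP[] /mapP[j _ ->]; rewrite ?normrN normr1.
- move=> c n; rewrite mem_cat => /orP[] /mapP[j + ->] nK.
    rewrite mem_filter mem_iota => /andP[_ jl] /=.
    have hj : j%:R <= (N + l)%:R :> R by rewrite ler_nat; lia.
    have hn : n%:R <= (N + l)%:R :> R by rewrite ler_nat.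
    have := ler0n R j; have := ler0n R n.
    by rewrite ler_norml; lra.
  rewrite mem_iota => jl /=.
  have hj : (N + j)%:R <= (N + l)%:R :> R by rewrite ler_nat; lia.
  have hn : n%:R <= (N + l)%:R :> R by rewrite ler_nat.
  have := ler0n R (N + j); have := ler0n R n.
  by rewrite ler_norml; lra.
- lia.
Qed.

Lemma energy_cutoff_le : (k < l)%N ->
  energy l cutoff
  <= (N + l)%:R * (l.+1%:R ^+ (l + l.-1) * (N + l)%:R ^+ l.-1) ^+ 2.
Proof.
move=> kl; set B := l.+1%:R ^+ _ * _.
have diff0 n : (N <= n)%N -> iter l fdiff cutoff n = 0.
  move=> Nn; rewrite (@eq_iter_fdiff _ _ (fun=> 0)) ?iter_fdiff0 // => m nm.
  by rewrite /cutoff ifF //; lia.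
(* For [n >= N + l] the differences start at [n - uphalf l >= N], where they vanish; at most [N + l]
   terms remain. *)
rewrite /energy (@series_eventually0 _ _ _ _ (N + l)) //; last first.
  move=> n Nln; rewrite norm_half_laplacian; last lia.
  rewrite diff0 ?normr0 ?expr0n //.
  by have := uphalf_half l; have := odd_double_half l; lia.
have -> : (N + l)%:R * B ^+ 2 = \sum_(0 <= n < N + l) B ^+ 2.
  by rewrite sumr_const_nat subn0 mulr_natl.
rewrite big_mkcond /=; apply: ler_sum => n _.
have B0 : 0 <= B by rewrite mulr_ge0 // exprn_ge0.
case: ifP => ln; last by rewrite exprn_ge0.
rewrite ler_pXn2r ?nnegrE // norm_half_laplacian //.
case: (ltnP (n - uphalf l) N) => h; first exact: iter_fdiff_cutoff_le.
by rewrite diff0 // normr0.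
Qed.

End CutOff.

(** * Lower bound for the Hardy sum, and the choice of the truncation point *)

Lemma hardy_sum_cutoff_ge (R : realType) (l k t : nat) : (0 < t)%N ->
  (t%:R ^+ l) ^+ 2 / l%:R ^+ (2 * l)
  <= hardy_sum l (@cutoff R l k (l + t)).
Proof.
move=> t0; rewrite /hardy_sum (@series_eventually0 _ _ _ _ (l + t)%N); last first.
- by move=> n hn; rewrite /cutoff ltnNge hn expr0n mul0r.
- exact: leq_addr.
have inv_ge0 n : 0 <= (n%:R ^+ (2 * l))^-1 :> R by rewrite invr_ge0 exprn_ge0.
(* Only the term [n = l] is kept, which [0 < t] places before the truncation. There the factors of
   [p] are at least 1 and the [l] factors of [r] at least [t]. *)
rewrite big_ltn; last lia.
rewrite -[leLHS]addr0 lerD //; last first.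
  by apply: sumr_ge0 => n _; rewrite mulr_ge0 // sqr_ge0.
rewrite ler_wpM2r //.
have p_ge1 : 1 <= \prod_(0 <= j < l | j != k) (l%:R - j%:R) :> R.
  rewrite big_nat_cond; elim/big_ind: _ => // [x y|j].
    by move=> x1 y1; rewrite -[leLHS]mulr1 ler_pM.
  case/andP=> /andP[_ jl] _; rewrite -natrB ?(ltnW jl) // ler1n; lia.
have r_ge : t%:R ^+ l <= \prod_(0 <= i < l) ((l + t + i)%:R - l%:R) :> R.
  rewrite -[in leLHS](subn0 l) -prodr_const_nat; apply: ler_prod => i _.
  by rewrite ler0n /= -natrB ?ler_nat; lia.
have cut_ge : t%:R ^+ l <= @cutoff R l k (l + t) l.
  rewrite /cutoff ifT ?cutoff_polyE; last lia.
  by rewrite -[leLHS]mul1r ler_pM // exprn_ge0.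
have tl0 : 0 <= t%:R ^+ l :> R by rewrite exprn_ge0.
by rewrite ler_pXn2r // nnegrE // (le_trans tl0).
Qed.

Lemma hardy_rellich_fails (R : realType) (l k : nat) (eps : R) :
  (k < l)%N -> 0 < eps ->
  exists u : nat -> R,
    [/\ finitely_supported u,
        forall j : nat, (j < l)%N -> j != k -> u j = 0,
        u k != 0 &
        energy l u < eps * hardy_sum l u].
Proof.
move=> kl eps0.
(* With [N = l + t] and [2 l + t <= (2 l + 1) t], the energy is at most [A] times [t ^ (2 l - 1)],
   and the Hardy sum at least [t ^ (2 l) / D]; hence [t > A * D / eps] suffices. *)
set A : R := (l.+1%:R ^+ (l + l.-1)) ^+ 2 * (2 * l).+1%:R ^+ (2 * l).-1.
set D : R := l%:R ^+ (2 * l).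
have D0 : 0 < D by rewrite exprn_gt0 // ltr0n; lia.
pose t := (Num.truncn (A * D / eps)).+1.
have t_gt : A * D / eps < t%:R by apply: Num.Theory.truncnS_gt.
have t0 : 0 < t%:R :> R by rewrite ltr0n.
exists (@cutoff R l k (l + t)); split.
- exact: finitely_supported_cutoff.
- exact: cutoff_eq0.
- by apply: cutoff_neq0; lia.
apply: (le_lt_trans (@energy_cutoff_le R l k (l + t) kl)).
apply: (@lt_le_trans _ _ (eps * ((t%:R ^+ l) ^+ 2 / D))); last first.
  by rewrite ler_pM2l //; apply: hardy_sum_cutoff_ge.
have -> : (l + t + l)%:R * (l.+1%:R ^+ (l + l.-1)
    * (l + t + l)%:R ^+ l.-1) ^+ 2
    = (l.+1%:R ^+ (l + l.-1)) ^+ 2 * (l + t + l)%:R ^+ (2 * l).-1 :> R.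
  rewrite exprMn mulrCA -(exprM (l + t + l)%:R) -exprS; congr (_ * _ ^+ _); lia.
have pow_le : (l + t + l)%:R ^+ (2 * l).-1
    <= (2 * l).+1%:R ^+ (2 * l).-1 * t%:R ^+ (2 * l).-1 :> R.
  rewrite -exprMn lerXn2r ?nnegrE ?mulr_ge0 // -natrM ler_nat /t; nia.
apply: (@le_lt_trans _ _ (A * t%:R ^+ (2 * l).-1)).
  by rewrite /A -mulrA ler_wpM2l // exprn_ge0 // exprn_ge0.
have -> : (t%:R ^+ l) ^+ 2 = t%:R * t%:R ^+ (2 * l).-1 :> R.
  by rewrite -exprM -exprS; congr (_ ^+ _); lia.
rewrite mulrA ltr_pdivlMr // mulrAC [ltRHS]mulrA.
rewrite ltr_pM2r ?exprn_gt0 //.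
by rewrite [ltRHS]mulrC -ltr_pdivrMr.
Qed.

Theorem mainTheorem7 (R : realType) :
  (* none of the l vanishing conditions can be dropped *)
  (forall l k : nat, (2 <= l)%N -> (k < l)%N ->
     ~ (forall u : nat -> R, finitely_supported u ->
          (forall j : nat, (j < l)%N -> j != k -> u j = 0) ->
          energy l u >= hardy_rellich_const R l * hardy_sum l u))
  /\
  (* the case l = 2 *)
  (forall eps : R, 0 < eps ->
     exists u : nat -> R,
       [/\ finitely_supported u, u 0%N = 0, u 1%N != 0 &
           \big[+%R/0]_(1 <= n <oo) `|laplacian u n| ^+ 2
           < eps * \big[+%R/0]_(2 <= n <oo) (u n ^+ 2 / n%:R ^+ 4)])
  /\
  (* the other cases: the same failure for every l and every dropped k *)
  (forall l k : nat, (2 <= l)%N -> (k < l)%N ->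
     forall eps : R, 0 < eps ->
     exists u : nat -> R,
       [/\ finitely_supported u,
           forall j : nat, (j < l)%N -> j != k -> u j = 0,
           u k != 0 &
           energy l u < eps * hardy_sum l u]).
Proof.
split; [|split].
- move=> l k _ kl hr.
  (* Being positive, the constant itself can serve as [eps]. *)
  have c0 : 0 < hardy_rellich_const R l.
    by rewrite exprn_gt0 // divr_gt0 ?mulr_gt0 ?exprn_gt0 ?ltr0n ?fact_gt0.
  have [u [fu u0 _]] := @hardy_rellich_fails R l k _ kl c0.
  by rewrite ltNge hr.
- move=> eps eps0.
  have [u [fu u0 u1 lt_u]] := @hardy_rellich_fails R 2 1 eps isT eps0.
  exists u; split => //; first exact: u0.
  (* For [l = 2] the filter [2 <= 2 * i] discards exactly [i = 0], so the partial sums agree. *)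
  have energy2E : (fun n => \sum_(1 <= i < n) `|laplacian u i| ^+ 2)
      = (fun n => \sum_(0 <= i < n | (2 <= 2 * i)%N) `|laplacian u i| ^+ 2).
    apply/funext => -[|n]; first by rewrite !big_geq.
    rewrite [RHS]big_mkcond [RHS]big_ltn //= add0r.
    rewrite big_nat_cond [RHS]big_nat_cond.
    by apply: eq_bigr => i /andP[/andP[i0 _] _]; rewrite ifT //; lia.
  by rewrite energy2E.
- by move=> l k _ kl eps eps0; apply: hardy_rellich_fails.
Qed.
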